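(* Let $S$ be a semigroup with finitely many $\mathscr L$-classes, and let $L_1,\dots, L_n$ be representative $\mathscr L$-classes for the $\mathscr D$-classes of $S$ (exactly one from each $\mathscr D$-class), with $L_1$ a minimal $\mathscr L$-class. For each $r=1,\dots,n$, let $m_r$ be the number of $\mathscr L$-classes in the $\mathscr D$-class of $L_r$, and let $\Gamma_r$ be the Schützenberger group of any $\mathscr H$-class of $L_r$. If $L_2,\dots, L_n$ are all $\mathscr H$-separable then \[ \mathrm{Ht}(\mathrm{LCong}(S))=m_1\, \mathrm{Ht}(\mathrm{Cong}({}^S L_1)) +\sum_{r=2}^n m_r\,\mathrm{Ht}(\mathrm{Sub}(\Gamma_r)). \]
   Context: The height $\mathrm{Ht}(P)$ of a poset $P$ is the supremum of the cardinalities of chains in $P$. For a semigroup $S$, $S^1$ is $S$ if $S$ is a monoid and otherwise $S$ with an identity adjoined. Green's relations: $x\mathrel{\mathscr L}y\Leftrightarrow S^1x=S^1y$, $x\mathrel{\mathscr R}y\Leftrightarrow xS^1=yS^1$, $\mathscr H=\mathscr L\cap\mathscr R$, $\mathscr D=\mathscr L\vee\mathscr R$ (join of equivalence relations). The set of $\mathscr L$-classes is partially ordered by $L_x\le L_y\Leftrightarrow S^1x\subseteq S^1y$; minimality of an $\mathscr L$-class refers to this order. A left congruence of $S$ is an equivalence relation $\sigma$ on $S$ with $(x,y)\in\sigma\Rightarrow(ax,ay)\in\sigma$ for all $a\in S$; $\mathrm{LCong}(S)$ is the lattice of left congruences. A left $S$-act is a set $A$ with maps $a\mapsto s\cdot a$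 ($s\in S$) satisfying $s\cdot(s'\cdot a)=(ss')\cdot a$; a congruence of $A$ is an equivalence relation $\sigma$ on $A$ such that $(a,b)\in\sigma$ implies $(s\cdot a,s\cdot b)\in\sigma$ for all $s\in S$; $\mathrm{Cong}(A)$ is the lattice of congruences. If $L$ is a minimal $\mathscr L$-class, then $sx\in L$ for all $s\in S$, $x\in L$, and ${}^S L$ denotes the left $S$-act on $L$ given by $s\cdot x=sx$. An $\mathscr L$-class $L$ is $\mathscr H$-separable if for all $x,y\in L$ with $(x,y)\notin\mathscr H$ there exists $s\in S$ such that precisely one of $sx$, $sy$ belongs to $L$. The (right) Schützenberger group of an $\mathscr H$-class $H$ is the group, under composition, of all maps $H\to H$, $x\mapsto xt$, where $t\in S^1$ satisfies $Ht\subseteq H$; up to isomorphism it depends only on the $\mathscr D$-class containing $H$. $\mathrm{Sub}(\Gamma)$ is the lattice of subgroups of $\Gamma$. *)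

(* Defs.v *)
From HB Require Import structures.
From mathcomp Require Import all_boot all_order all_classical.

Set Implicit Arguments.
Unset Strict Implicit.
Unset Printing Implicit Defensive.

Local Open Scope classical_set_scope.
Local Open Scope card_scope.
Local Open Scope group_scope.

(** Cardinals are represented by types (or sets) up to [#=], so that products
    and disjoint sums of types are products and sums of cardinals. *)

Definition is_card_sup T (F : set (set T)) (K : set T) : Prop :=
  (forall C, F C -> C #<= K) /\
  (forall (U : Type) (B : set U), (forall C, F C -> C #<= B) -> K #<= B).

Lemma card_min_exists T (F : set (set T)) (A0 : set T) : F A0 ->
  exists2 K, F K & forall B, F B -> K #<= B.
Proof.
move=> FA0.
pose P (M : set (set T -> T)) :=
  (forall f A, M f -> F A -> A (f A)) /\
  (forall f g A, M f -> M g -> F A -> f A = g A -> f = g).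
have [|M [[M1 M2] Mmax]] := @Zorn_bigcup _ P.
  move=> G GP Gtot; split=> [f A [X GX Xf] FA|f g A [X GX Xf] [Y GY Yg] FA fg].
    by have [h _] := GP _ GX; exact: h Xf FA.
  have [XY|YX] := Gtot _ _ GX GY.
    by have [_ h] := GP _ GY; apply: h fg => //; exact: XY.
  by have [_ h] := GP _ GX; apply: h fg => //; exact: YX.
have [[A FA AM]|noA] :=
    pselect (exists2 A, F A & forall a, A a -> exists2 f, M f & f A = a).
  exists A => // B FB; apply: (@card_le_trans _ _ _ M).
    by apply: card_le_trans (card_image_le (fun f => f A) M); exact: subset_card_le.
  have injB : {in M &, injective (fun f => f B)}.
    by move=> f g; rewrite !inE => Mf Mg; exact: M2.
  have : (fun f => f B) @` M #<= B.
    by apply: subset_card_le => _ [f Mf <-]; exact: M1 Mf _.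
  by have /card_eqPle[_ le1] := inj_card_eq injB; exact: card_le_trans.
have miss A : F A -> exists a, A a /\ forall f, M f -> f A <> a.
  move=> FA; apply: contrapT => nA; apply: noA; exists A => // a Aa.
  apply: contrapT => nf; apply: nA; exists a; split=> // f Mf fa.
  by apply: nf; exists f.
have [t0 _] := miss _ FA0.
have /choice[f0 f0P] : forall A, exists a,
    F A -> A a /\ forall f, M f -> f A <> a.
  move=> A; have [FA|nFA] := pselect (F A); last by exists t0 => /nFA.
  by have [a ?] := miss _ FA; exists a.
have Mf0 : M f0.
  have PM' : P (M `|` [set f0]).
    split=> [f A [Mf|->] FA|f g A [Mf|->] [Mg|->] FA] //.
    - exact: M1 Mf _.
    - by have [] := f0P _ FA.
    - exact: M2.
    - by move=> fg; have [_ /(_ _ Mf)] := f0P _ FA.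
    - by move=> fg; have [_ /(_ _ Mg)] := f0P _ FA; rewrite fg.
  apply: contrapT => nMf0; apply: (Mmax (M `|` [set f0])) => //.
  by split; [move=> f Mf; left | move=> /(_ f0); apply: contra_not nMf0; apply; right].
by have [_ /(_ _ Mf0)] := f0P _ FA0.
Qed.

Lemma card_total T U (A : set T) (B : set U) : A #<= B \/ B #<= A.
Proof.
pose iA : set (T + U) := inl @` A; pose iB : set (T + U) := inr @` B.
have eA : iA #= A by apply: inj_card_eq => x y _ _ [].
have eB : iB #= B by apply: inj_card_eq => x y _ _ [].
pose F : set (set (T + U)) := [set X | X = iA \/ X = iB].
have [K FK Kle] := @card_min_exists _ F iA (or_introl erefl).
case: FK Kle => -> Kle; [left|right].
  by rewrite -(card_le_eql eA) -(card_le_eqr eB); apply: Kle; right.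
by rewrite -(card_le_eqr eA) -(card_le_eql eB); apply: Kle; left.
Qed.

Lemma card_sup_exists T (F : set (set T)) : exists K, is_card_sup F K.
Proof.
pose UB := [set K : set T | forall C, F C -> C #<= K].
have [K UK Kmin] := @card_min_exists _ UB setT (fun C _ => card_leT C).
exists K; split=> // U B UB_B; have [//|BK] := card_total K B.
have /card_subP[C gB _] := BK.
rewrite -(card_le_eqr gB); apply: Kmin => X FX.
by rewrite (card_le_eqr gB); exact: UB_B.
Qed.

Section Height.
Context {d : Order.disp_t} {T : porderType d}.

(** Chains of the subposet [P] of [T]. *)
Definition chains (P : set T) : set (set T) :=
  [set C | C `<=` P /\ total_on C (fun x y => x <= y)%O].

(** A type whose cardinality is the supremum, in the class of all cardinals, of
    the cardinalities of the chains of [P]; finite and infinite values are both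
    allowed, and a chain is measured by its number of elements. *)
Definition height (P : set T) : Type :=
  set_type (projT1 (cid (card_sup_exists (chains P)))).

Lemma heightP (P : set T) :
  (forall C, chains P C -> C #<= [set: height P]) /\
  (forall (U : Type) (B : set U),
    (forall C, chains P C -> C #<= B) -> [set: height P] #<= B).
Proof.
rewrite /height; case: cid => K /= [ub lub]; have eK := card_setT K.
split=> [C PC|U B CB]; first by rewrite (card_le_eqr eK); exact: ub.
by rewrite (card_le_eql eK); exact: lub.
Qed.

End Height.

(** Binary relations on [T] are sets of pairs, ordered by inclusion. *)
Definition is_equiv T (E : set (T * T)) : Prop :=
  [/\ forall x, E (x, x),
      forall x y, E (x, y) -> E (y, x) &
      forall x y z, E (x, y) -> E (y, z) -> E (x, z)].

Definition classes T (E : set (T * T)) : set (set T) :=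
  range (fun x => [set y | E (x, y)]).

Section Green.
Variable S : semigroupType.
Implicit Types (x y : S) (K L H : set S).

Definition is_identity (e : S) : Prop := forall x, e * x = x /\ x * e = x.

(** [S1] is the semigroup [S^1]: [Some s] stands for [s : S], and [None] for
    the adjoined identity, which is present only when [S] is not a monoid. *)
Definition S1 : set (option S) :=
  [set s | s = None -> ~ exists e, is_identity e].

Definition lmul1 (s : option S) x : S := if s is Some a then a * x else x.
Definition rmul1 x (s : option S) : S := if s is Some a then x * a else x.

Definition lideal x : set S := [set lmul1 s x | s in S1].
Definition rideal x : set S := [set rmul1 x s | s in S1].

Definition greenL : set (S * S) := [set p | lideal p.1 = lideal p.2].
Definition greenR : set (S * S) := [set p | rideal p.1 = rideal p.2].
Definition greenH : set (S * S) := greenL `&` greenR.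
Definition greenD : set (S * S) := smallest (@is_equiv S) (greenL `|` greenR).

Definition Lclasses : set (set S) := classes greenL.
Definition Hclasses : set (set S) := classes greenH.
Definition Dclasses : set (set S) := classes greenD.

(** The order on L-classes; it does not depend on the chosen elements. *)
Definition Lclass_le K L : Prop :=
  forall x y, K x -> L y -> lideal x `<=` lideal y.

Definition minimal_Lclass L : Prop :=
  Lclasses L /\ forall K, Lclasses K -> Lclass_le K L -> K = L.

Definition Hseparable L : Prop :=
  forall x y, L x -> L y -> ~ greenH (x, y) ->
    exists s : S, (L (s * x) /\ ~ L (s * y)) \/ (~ L (s * x) /\ L (s * y)).

Definition LCong : set (set (S * S)) :=
  [set E | is_equiv E /\ forall a x y, E (x, y) -> E (a * x, a * y)].

Record lact := Lact {
  lact_sort :> Type;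
  act : S -> lact_sort -> lact_sort;
  actA : forall s s' a, act s (act s' a) = act (s * s') a }.

Definition Cong (A : lact) : set (set (A * A)) :=
  [set E | is_equiv E /\ forall s a b, E (a, b) -> E (act s a, act s b)].

Lemma S1_None_or_id : S1 None \/ exists e, is_identity e.
Proof. by have [e|n] := pselect (exists e, is_identity e); [right|left]. Qed.

Lemma lideal_refl x : lideal x x.
Proof.
have [n|[e ide]] := S1_None_or_id; first by exists None.
by exists (Some e) => //=; case: (ide x).
Qed.

Lemma rideal_refl x : rideal x x.
Proof.
have [n|[e ide]] := S1_None_or_id; first by exists None.
by exists (Some e) => //=; case: (ide x).
Qed.

Lemma lideal_sub x y : lideal y x -> lideal x `<=` lideal y.
Proof.
case=> [[s|]] S1s <- // _ [[t|] S1t <-] /=.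
  by exists (Some (t * s)); rewrite //= mulgA.
by exists (Some s).
Qed.

Lemma rideal_sub x y : rideal y x -> rideal x `<=` rideal y.
Proof.
case=> [[s|]] S1s <- // _ [[t|] S1t <-] /=.
  by exists (Some (s * t)); rewrite //= mulgA.
by exists (Some s).
Qed.

Lemma minimal_Lclass_stable L (s x : S) : minimal_Lclass L -> L x -> L (s * x).
Proof.
move=> [[z _ zL] Lmin]; rewrite -{1 2}zL => zx.
have KL : [set y | greenL (s * x, y)] = L.
  apply: Lmin; first by exists (s * x).
  move=> a b sxa; rewrite -zL => zb.
  rewrite -[lideal a]sxa -[lideal b]zb [lideal z]zx /=.
  by apply: lideal_sub; exists (Some s).
by rewrite zL -KL.
Qed.

Definition minimal_act_fun L (Lmin : minimal_Lclass L) (s : S)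
    (x : set_type L) : set_type L :=
  SigSub (mem_set (minimal_Lclass_stable s Lmin (set_valP x))).

Lemma minimal_act_funA L (Lmin : minimal_Lclass L) s s' (x : set_type L) :
  minimal_act_fun Lmin s (minimal_act_fun Lmin s' x) =
  minimal_act_fun Lmin (s * s') x.
Proof. by apply: val_inj; rewrite /= mulgA. Qed.

Definition minimal_act L (Lmin : minimal_Lclass L) : lact :=
  Lact (minimal_act_funA Lmin).

(** The maps [x |-> x t] of [H] to itself with [t] in [S^1]; that [H t] is
    contained in [H] is carried by the type of [f]. *)
Definition right_translations H : set (set_type H -> set_type H) :=
  [set f | exists2 t, S1 t & forall x : set_type H, val (f x) = rmul1 (val x) t].
Arguments right_translations : clear implicits.

Definition schutz H (hH : Hclasses H) : Type := set_type (right_translations H).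

End Green.

Arguments S1 S _ : clear implicits.
Arguments greenL S _ : clear implicits.
Arguments greenR S _ : clear implicits.
Arguments greenH S _ : clear implicits.
Arguments greenD S _ : clear implicits.
Arguments Lclasses S _ : clear implicits.
Arguments Hclasses S _ : clear implicits.
Arguments Dclasses S _ : clear implicits.
Arguments LCong S _ : clear implicits.
Arguments Cong {S} A _.
Arguments right_translations {S} H _.

Section SchutzenbergerGroup.
Context {S : semigroupType} {H : set S} (hH : Hclasses S H).
Local Notation G := (schutz hH).

HB.instance Definition _ := Choice.on G.

Lemma schutzP (f : G) : right_translations H (val f).
Proof. exact: (set_valP f). Qed.

Lemma schutz_one_subproof : right_translations H id.
Proof.
have [n|[e ide]] := S1_None_or_id S; first by exists None.
by exists (Some e) => //= x; case: (ide (val x)).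
Qed.

Lemma schutz_mul_subproof (f g : G) :
  right_translations H (val f \o val g).
Proof.
have [[t|] tS fE] := schutzP f; have [[u|] uS gE] := schutzP g.
- by exists (Some (u * t)) => //= x; rewrite fE gE /= mulgA.
- by exists (Some t) => //= x; rewrite fE gE.
- by exists (Some u) => //= x; rewrite fE gE.
- by exists None => //= x; rewrite fE gE.
Qed.

Definition schutz_one : G := SigSub (mem_set schutz_one_subproof).
Definition schutz_mul (f g : G) : G := SigSub (mem_set (schutz_mul_subproof f g)).

Lemma Hclass_LR (x y : set_type H) :
  lideal (val x) = lideal (val y) /\ rideal (val x) = rideal (val y).
Proof.
case: x y => x /set_mem Hx [y /set_mem Hy] /=.
case: hH Hx Hy => z _ <- /= [/= Lx Rx] [/= Ly Ry].
by split; [exact: etrans (esym Lx) Ly | exact: etrans (esym Rx) Ry].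
Qed.

Lemma Hclass_in (x : set_type H) (y : S) : lideal (val x) = lideal y ->
  rideal (val x) = rideal y -> H y.
Proof.
case: x => x /set_mem Hx /=; case: hH Hx => z _ <- /= [/= Lx Rx] Lxy Rxy.
by split; [exact: etrans Lx Lxy | exact: etrans Rx Rxy].
Qed.

Lemma rmul1_lmul1 (s t : option S) (x : S) :
  rmul1 (lmul1 s x) t = lmul1 s (rmul1 x t).
Proof. by case: s t => [s|] [t|] //=; rewrite mulgA. Qed.

Lemma schutz_inv_subproof (f : G) : exists g : G,
  schutz_mul g f = schutz_one /\ schutz_mul f g = schutz_one.
Proof.
have [[h]|noh] := pselect (inhabited (set_type H)); last first.
  exists schutz_one; split; apply: val_inj; apply/funext => x;
    by case: noh; constructor.
pose f' : set_type H -> set_type H := val f.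
have [t tS fE] : right_translations H f' := schutzP f.
have [u uS uE] : exists2 u, S1 S u & rmul1 (val (f' h)) u = val h.
  have [_ Rfh] := Hclass_LR (f' h) h.
  have := rideal_refl (val h); rewrite -Rfh => -[u uS uE]; by exists u.
(* every element of H is of the form s h, hence t then u acts trivially *)
have tuE (x : set_type H) : rmul1 (rmul1 (val x) t) u = val x.
  have [Lhx _] := Hclass_LR h x.
  have := lideal_refl (val x); rewrite -Lhx => -[s sS <-].
  by rewrite !rmul1_lmul1 -[rmul1 _ t]fE uE.
have yut (y : set_type H) : exists2 s, S1 S s &
    val y = lmul1 s (val (f' h)) /\ rmul1 (val y) u = lmul1 s (val h).
  have [Ly _] := Hclass_LR (f' h) y.
  have := lideal_refl (val y); rewrite -Ly => -[s sS sE].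
  by exists s => //; rewrite -sE rmul1_lmul1 uE.
have utE (y : set_type H) : rmul1 (rmul1 (val y) u) t = val y.
  by have [s _ [-> ->]] := yut y; rewrite fE rmul1_lmul1.
have uH (y : set_type H) : H (rmul1 (val y) u).
  apply: (Hclass_in (x := h)).
    have [s sS [yE ->]] := yut y.
    apply/seteqP; split; last by apply: lideal_sub; exists s.
    apply: lideal_sub.
    have [Lyf _] := Hclass_LR y (f' h).
    have := lideal_refl (val (f' h)); rewrite -Lyf => -[s' s'S s'E].
    exists s' => //.
    have := congr1 (fun z => rmul1 z u) s'E.
    by rewrite /= yE !rmul1_lmul1 uE => ->.
  have [_ ->] := Hclass_LR h y.
  apply/seteqP; split; apply: rideal_sub; last by exists u.
  by exists t => //; exact: utE.
pose g (y : set_type H) : set_type H := SigSub (mem_set (uH y)).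
have gP : right_translations H g by exists u.
exists (SigSub (mem_set gP)); split; apply: val_inj; apply/funext => x; apply: val_inj.
  by rewrite /= -/f' fE tuE.
by rewrite /= -/f' fE /= utE.
Qed.

Definition schutz_inv (f : G) : G := projT1 (cid (schutz_inv_subproof f)).

Lemma schutz_mulA : associative schutz_mul.
Proof. by move=> f g h; apply: val_inj. Qed.

Lemma schutz_mul1g : left_id schutz_one schutz_mul.
Proof. by move=> f; apply: val_inj. Qed.

Lemma schutz_mulg1 : right_id schutz_one schutz_mul.
Proof. by move=> f; apply: val_inj. Qed.

Lemma schutz_mulVg : left_inverse schutz_one schutz_inv schutz_mul.
Proof. by move=> f; rewrite /schutz_inv; case: cid => g []. Qed.

Lemma schutz_mulgV : right_inverse schutz_one schutz_inv schutz_mul.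
Proof. by move=> f; rewrite /schutz_inv; case: cid => g []. Qed.

HB.instance Definition _ := isGroup.Build G
  schutz_mulA schutz_mul1g schutz_mulg1 schutz_mulVg schutz_mulgV.

End SchutzenbergerGroup.

Definition Subgroups (G : groupType) : set (set G) :=
  [set K | group_closed (mem K)].

Arguments Subgroups G _ : clear implicits.

(* Main.v *)
Require Import Defs.
From HB Require Import structures.
From mathcomp Require Import all_boot all_order finmap all_classical.

(** For an L-class K let a local congruence of K be an equivalence E on K such
    that for all (x, y) in E and all s, either (s x, s y) is in E, or neither
    s x nor s y is in K: these are the congruences of the act K with a zero
    adjoined in which the zero is isolated. The theorem splits into a formula
    that holds as soon as S has finitely many L-classes,

      Ht(LCong S) = sum over all L-classes K of Ht(local congruences of K),

    which is [height_LCong], and the computation of each summand: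
    - it depends only on the D-class of K ([height_local_cong_D]), because
      right translations between R-related elements are bijections of L-classes
      that commute with all left multiplications (Green's lemma);
    - for K minimal every s maps K to itself, so local congruences are the
      congruences of the act on K ([height_local_cong_minimal]);
    - for K H-separable, local congruences are contained in H, since an s that
      sends only one of x, y into K separates them; hence they are given by the
      orbits of the subgroups of the Schuetzenberger group acting on K from the
      right ([height_local_cong_Hseparable]).

    For the sum formula, rank the L-classes linearly so that s x never ranks
    above x. The elements below a given rank then form a left ideal, and the
    L-classes are the layers between successive left ideals. Say that a left
    congruence is joined at a layer when it relates some element of the layer
    to an element below it; by transitivity of S^1 on the layer it then relates
    every element of the layer to an element below. So, among comparable left
    congruences, one that is joined at K is determined up to K by what it does
    below K, while one that is not joined restricts on K to a local congruence
    and is determined up to K by that together with what it does below.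

    From a chain of left congruences this gives chains of local congruences
    whose sizes add up to at least its own ([LCong_chain_split]). Conversely,
    chains of local congruences are stacked: at the layer K, collapse everything
    below K, use a local congruence on K, and put equality above
    ([LCong_chain_glue]).

    Heights are suprema of cardinals, so adding them requires that a finite
    supremum be attained, and that a finite sum of cardinals, one of which is
    infinite, be equal to the largest of them. *)

Local Open Scope classical_set_scope.
Local Open Scope card_scope.
Local Open Scope group_scope.

Set Implicit Arguments.
Unset Strict Implicit.
Unset Printing Implicit Defensive.

(** * Cardinal arithmetic *)

Lemma card_le_of_inj T U (A : set T) (B : set U) (f : T -> U) :
  (forall x, A x -> B (f x)) ->
  (forall x y, A x -> A y -> f x = f y -> x = y) -> A #<= B.
Proof.
move=> fAB finj.
have injf : {in A &, injective f} by move=> x y; rewrite !inE; exact: finj.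
have /card_eqPle[_ le1] := inj_card_eq injf.
by apply: card_le_trans le1 _; apply: subset_card_le => _ [x Ax <-]; exact: fAB.
Qed.

Lemma card_leTP T U (B : set U) : [set: T] #<= B <->
  exists f : T -> U, (forall x, B (f x)) /\ injective f.
Proof.
split=> [/card_leP[f]|[f [fB finj]]]; last first.
  by apply: (@card_le_of_inj _ _ _ _ f) => // x y _ _; exact: finj.
exists (fun x => val (f (SigSub (mem_set (I : setT x))))); split=> [x|x y].
  exact: set_valP.
move=> /val_inj/(in2TT (@inj _ _ _ f)) e; exact: (congr1 val e).
Qed.

Lemma card_eq_le_le T U (A : set T) (B : set U) : A #<= B -> B #<= A -> A #= B.
Proof. by move=> *; apply/card_eqPle. Qed.

(** Take a maximal family of pairwise disjoint injective sequences in A. By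
    maximality only finitely many points of A are missed, and one of the
    sequences absorbs them. *)
Lemma infinite_card_prod_nat T (A : set T) : infinite_set A ->
  exists M : set (nat -> T), A #= M `*` [set: nat].
Proof.
move=> infA.
pose P (M : set (nat -> T)) :=
  (forall f, M f -> injective f /\ forall n, A (f n)) /\
  (forall f g m n, M f -> M g -> f m = g n -> f = g).
have [|M [[Minj Mdisj] Mmax]] := @Zorn_bigcup _ P.
  move=> G GP Gtot; split=> [f [X GX Xf]|f g p q [X GX Xf] [Y GY Yg]].
    by have [h _] := GP _ GX; exact: h.
  have [XY|YX] := Gtot _ _ GX GY.
    by have [_ h] := GP _ GY; apply: h => //; exact: XY.
  by have [_ h] := GP _ GX; apply: h => //; exact: YX.
pose R := A `\` [set a | exists2 f, M f & exists n, f n = a].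
have finR : finite_set R.
  apply: contrapT => /infiniteP/card_leTP[g [gR ginj]].
  have nMg : ~ M g by move=> Mg; have [_] := gR 0; apply; exists g => //; exists 0.
  apply: (Mmax (M `|` [set g])).
    by split=> [f Mf|/(_ g)]; [left | move=> h; apply/nMg/h; right].
  split=> [f [/Minj//|->]|f h p q [Mf|->] [Mh|->] //].
  - by split=> // n; have [] := gR n.
  - exact: Mdisj.
  - by move=> e; have [_ []] := gR q; exists f => //; exists p.
  - by move=> e; have [_ []] := gR p; exists h => //; exists q.
(* [f0] is the sequence that absorbs the finite rest [R]. *)
have [f0 Mf0] : exists f, M f.
  apply: contrapT => nM; apply: infA; apply: sub_finite_set finR => a Aa.
  by split=> // -[f Mf _]; apply: nM; exists f.
pose D := R `|` range f0.
have /countable_injP[c cinj] : countable D.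
  have : countable (\bigcup_(b in [set: bool]) if b then R else range f0).
    apply: bigcup_countable => // -[] _; first exact: finite_set_countable.
    exact: card_image_le.
  by apply: sub_countable; apply: subset_card_le => a [Ra|Ra]; [exists true|exists false].
have cinj' a b : D a -> D b -> c a = c b -> a = b.
  by move=> Da Db; apply: cinj; rewrite inE.
have /choice[u uP] : forall a, exists p : (nat -> T) * nat,
    A a -> (D a /\ p = (f0, c a)) \/ (~ D a /\ M p.1 /\ p.1 p.2 = a).
  move=> a; have [Da|nDa] := pselect (D a); first by exists (f0, c a); left.
  have [[f Mf [n fn]]|na] := pselect (exists2 f, M f & exists n, f n = a).
    by exists (f, n); right.
  by exists (f0, 0) => Aa; case: nDa; left; split.
exists M; apply: card_eq_le_le.
  apply: (@card_le_of_inj _ _ _ _ u) => [a /uP[[_ ->]|[_ []]]//|a b].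
  move=> /uP[[Da ->]|[nDa [Ma ua]]] /uP[[Db ->]|[nDb [Mb ub]]].
  - by case=> /cinj'; apply.
  - by move=> e; case: nDb; right; rewrite -ub -e /=; exists (c a).
  - by move=> e; case: nDa; right; rewrite -ua e /=; exists (c b).
  - by move=> e; rewrite -ua e.
apply: (@card_le_of_inj _ _ _ _ (fun p : (nat -> T) * nat => p.1 p.2)).
  by move=> [f n] [/= /Minj[]].
move=> [f p] [g q] [/= Mf _] [/= Mg _] e; have fg := Mdisj _ _ _ _ Mf Mg e.
by subst g; have [finj _] := Minj _ Mf; rewrite (finj _ _ e).
Qed.

(** An infinite cardinal absorbs countable sums: write it as M times nat; then
    the index of the summand is encoded in the factor nat. *)
Lemma card_le_countable_sum (I : countType) (F : I -> Type) U (B : set U) :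
  infinite_set B -> (forall i, [set: F i] #<= B) -> [set: {i : I & F i}] #<= B.
Proof.
move=> /infinite_card_prod_nat[M BM] FB; rewrite (card_le_eqr BM).
have exg i : exists g : F i -> (nat -> U) * nat,
    (forall x, M (g x).1) /\ injective g.
  have := FB i; rewrite (card_le_eqr BM) => /card_leTP[g [gM ginj]].
  by exists g; split=> // x; have [] := gM x.
pose g i := projT1 (cid (exg i)).
have gP i : (forall x, M (g i x).1) /\ injective (g i) := projT2 (cid (exg i)).
apply/card_leTP.
exists (fun p : {i : I & F i} => let: existT i x := p in
  ((g i x).1, choice.pickle (i, (g i x).2))); split=> [[i x]|[i x] [j y]] /=.
  by split=> //; have [] := gP i.
case=> e /(pcan_inj choice.pickleK)[ij]; subst j => e2.
have [_ ginj] := gP i; congr existT; apply: ginj.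
by rewrite (surjective_pairing (g i x)) (surjective_pairing (g i y)) e e2.
Qed.

Lemma card_eq_can T U (f : T -> U) (g : U -> T) :
  cancel f g -> cancel g f -> [set: T] #= [set: U].
Proof.
move=> fK gK; apply: card_eq_le_le; apply/card_leTP.
  by exists f; split=> //; exact: can_inj fK.
by exists g; split=> //; exact: can_inj gK.
Qed.

Lemma card_le_sum_cong (I : eqType) (F G : I -> Type) :
  (forall i, [set: F i] #<= [set: G i]) ->
  [set: {i & F i}] #<= [set: {i & G i}].
Proof.
move=> FG; have exf i : exists f : F i -> G i, injective f.
  by have /card_leTP[f [_ finj]] := FG i; exists f.
pose f i := projT1 (cid (exf i)).
have finj i : injective (f i) := projT2 (cid (exf i)).
apply/card_leTP; exists (fun p => Tagged G (f _ (tagged p))).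
split=> // -[i x] [j y] e; have /= ij := congr1 tag e; subst j.
by congr existT; apply: finj; exact: eq_from_Tagged e.
Qed.

Lemma card_eq_sum_cong (I : eqType) (F G : I -> Type) :
  (forall i, [set: F i] #= [set: G i]) ->
  [set: {i & F i}] #= [set: {i & G i}].
Proof.
by move=> FG; apply: card_eq_le_le; apply: card_le_sum_cong => i;
  have /card_eqPle[] := FG i.
Qed.

(** * Heights *)

Lemma height_ge d (T : porderType d) (P C : set T) :
  chains P C -> C #<= [set: height P].
Proof. by have [ub _] := heightP P; exact: ub. Qed.

Lemma height_le d (T : porderType d) (P : set T) U (B : set U) :
  (forall C, chains P C -> C #<= B) -> [set: height P] #<= B.
Proof. by have [_ lub] := heightP P; exact: lub. Qed.

(** If a finite supremum were not attained, its predecessor would still bound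
    all chains. *)
Lemma finite_height_attained d (T : porderType d) (P : set T) :
  finite_set [set: height P] -> exists2 C, chains P C & C #= [set: height P].
Proof.
move=> /finite_setP[n hn]; apply: contrapT => noC.
have ltC C : chains P C -> exists2 k, (k < n)%N & C #= `I_k.
  move=> PC; have := height_ge PC; rewrite (card_le_eqr hn) => Cn.
  have /finite_setP[k Ck] := card_le_finite Cn (finite_II n).
  exists k => //; rewrite ltn_neqAle -card_le_II -(card_le_eql Ck) Cn andbT.
  apply/eqP => kn; apply: noC; exists C => //.
  by rewrite (card_eqr hn) -kn.
have : [set: height P] #<= `I_n.-1.
  apply: height_le => C /ltC[k kn Ck].
  by rewrite (card_le_eql Ck) card_le_II -ltnS (leq_trans kn) // leqSpred.
rewrite (card_le_eql hn) card_le_II.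
have [k kn _] : exists2 k, (k < n)%N & (set0 : set T) #= `I_k.
  by apply: ltC; split=> // x.
by case: n kn {hn ltC} => // n _ /=; rewrite ltnn.
Qed.

Lemma height_embed d d' (T : porderType d) (T' : porderType d')
    (P : set T) (Q : set T') (f : T -> T') :
  (forall x, P x -> Q (f x)) ->
  (forall x y, P x -> P y -> (x <= y)%O -> (f x <= f y)%O) ->
  (forall x y, P x -> P y -> f x = f y -> x = y) ->
  [set: height P] #<= [set: height Q].
Proof.
move=> fPQ fle finj; apply: height_le => C [CP Ctot].
apply: (@card_le_trans _ _ _ (f @` C)).
  apply: (@card_le_of_inj _ _ _ _ f) => [x Cx|x y /CP Px /CP]; first by exists x.
  exact: finj.
apply: height_ge; split=> [_ [x /CP Px <-]|_ _ [x Cx <-] [y Cy <-]].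
  exact: fPQ.
by have [xy|yx] := Ctot _ _ Cx Cy; [left|right]; apply: fle => //; exact: CP.
Qed.

Lemma card_max_exists (I : finType) (F : I -> Type) : I ->
  exists i, forall j, [set: F j] #<= [set: F i].
Proof.
move=> i0; suff [i iP] : exists i, forall j, j \in i0 :: enum I ->
    [set: F j] #<= [set: F i].
  by exists i => j; apply: iP; rewrite inE mem_enum orbT.
elim: (enum I) => [|k s [i iP]]; first by exists i0 => j; rewrite inE => /eqP->.
have [ik|ki] := card_total [set: F i] [set: F k].
  exists k => j; rewrite !inE => /or3P[/eqP->|/eqP->//|js].
    by apply: card_le_trans ik; apply: iP; rewrite inE eqxx.
  by apply: card_le_trans ik; apply: iP; rewrite inE js orbT.
exists i => j; rewrite !inE => /or3P[/eqP->|/eqP->//|js]; apply: iP.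
  by rewrite inE eqxx.
by rewrite inE js orbT.
Qed.

(** Heights add when chains of Q can be split into chains of the P i, and chains
    of the P i can be assembled into a chain of Q, without loss of elements.
    If some P i has
    infinite height, only the chains of the largest P i matter for the lower
    bound, so suprema that are not attained cause no difficulty. *)
Lemma height_sum (I : finType) d d' (T : porderType d) (T' : porderType d')
    (P : I -> set T) (Q : set T') :
  (forall C, chains Q C -> exists D : I -> set T,
    (forall i, chains (P i) (D i)) /\ C #<= [set p : I * T | D p.1 p.2]) ->
  (forall D : I -> set T, (forall i, chains (P i) (D i)) ->
    exists2 C, chains Q C & [set p : I * T | D p.1 p.2] #<= C) ->
  [set: height Q] #= [set: {i : I & height (P i)}].
Proof.
move=> QP PQ; apply: card_eq_le_le.
  apply: height_le => C /QP[D [DP CD]]; apply: card_le_trans CD _.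
  have exf i : exists f : set_type (D i) -> height (P i), injective f.
    have := height_ge (DP i); rewrite -(card_le_eql (card_setT (D i))).
    by move=> /card_leTP[f [_ finj]]; exists f.
  pose f i := projT1 (cid (exf i)).
  have finj i : injective (f i) := projT2 (cid (exf i)).
  have memD (p : set_type [set p : I * T | D p.1 p.2]) :
    (val p).2 \in D (val p).1 by apply: mem_set; exact: (set_valP p).
  rewrite -(card_le_eql (card_setT _)); apply/card_leTP.
  exists (fun p : set_type [set p : I * T | D p.1 p.2] =>
    Tagged (fun i => height (P i))
     (f (val p).1 (SigSub (memD p)))); split=> // p q.
  move: p q => [[i x] hx] [[j y] hy] e; apply: val_inj => /=.
  have /= ij := congr1 tag e; subst j.
  by have /finj/(congr1 val)/= -> := eq_from_Tagged e.
have [fin|] := pselect (forall i, finite_set [set: height (P i)]).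
  have exD i : exists D, chains (P i) D /\
      exists f : height (P i) -> T, (forall x, D (f x)) /\ injective f.
    have [D DP /card_esym/card_eqPle[hD _]] := finite_height_attained (fin i).
    by exists D; split=> //; apply/card_leTP.
  pose D i := projT1 (cid (exD i)).
  have DP i : chains (P i) (D i) by rewrite /D; case: cid => ? [].
  have exf i : exists f : height (P i) -> T, (forall x, D i (f x)) /\ injective f.
    by rewrite /D; case: cid => ? [].
  pose f i := projT1 (cid (exf i)).
  have fP i : (forall x, D i (f i x)) /\ injective (f i) := projT2 (cid (exf i)).
  have [C QC DC] := PQ D DP.
  apply: card_le_trans (height_ge QC); apply: card_le_trans DC.
  apply/card_leTP; exists (fun u : {i : I & height (P i)} => (tag u, f _ (tagged u))).
  split=> [[i x]|[i x] [j y]] /=; first by have [] := fP i.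
  by move=> [e]; subst j; have [_ h] := fP i => /h->.
(* Otherwise the largest summand is infinite and equals the whole sum. *)
move=> /existsNP[i0 infi0].
have [i iP] := @card_max_exists I (fun i => height (P i)) i0.
have infi : infinite_set [set: height (P i)].
  by apply: contra_not infi0; exact: card_le_finite.
apply: (card_le_trans (card_le_countable_sum infi iP)).
apply: height_le => C [CP Ctot].
pose D j := if j == i then C else set0.
have DP j : chains (P j) (D j).
  by rewrite /D; case: eqP => [->//|_]; split=> // x.
have [B QB DB] := PQ D DP; apply: card_le_trans (height_ge QB).
apply: card_le_trans DB; apply: (@card_le_of_inj _ _ _ _ (pair i)).
  by move=> x Cx; rewrite /= /D eqxx.
by move=> x y _ _ [].
Qed.

(** * Chains of left congruences, layer by layer *)

Section LocalCongruences.
Variable S : semigroupType.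
Implicit Types (x y : S) (K : set S) (E F N : set (S * S)).

(** Let I be a left ideal such that I and K together form a left ideal too. The
    last condition makes E, united with the universal relation on I, compatible
    with left multiplication: if s x falls from K into I, then so does s y. *)
Definition local_cong K : set (set (S * S)) :=
  [set E | [/\ forall x y, E (x, y) -> K x /\ K y,
               forall x, K x -> E (x, x),
               forall x y, E (x, y) -> E (y, x),
               forall x y z, E (x, y) -> E (y, z) -> E (x, z) &
               forall s x y, E (x, y) ->
                 E (s * x, s * y) \/ (~ K (s * x) /\ ~ K (s * y))]].

(** [rho] ranks the elements by their L-class, and [lev] lists the ranks that
    occur; [j1] is the lowest layer. *)
Section Decomposition.
Variables (rho : S -> nat) (J : finType) (lev : J -> nat) (j1 : J).
Hypothesis rhoM : forall s x, (rho (s * x) <= rho x)%N.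
Hypothesis rho_trans : forall x y, rho x = rho y -> exists s, lmul1 s x = y.
Hypothesis lev_inj : injective lev.
Hypothesis lev_hit : forall j, exists x, rho x = lev j.
Hypothesis lev_cover : forall x, exists j, rho x = lev j.
Hypothesis lev1 : forall j, (lev j1 <= lev j)%N.

Definition layer j : set S := [set x | rho x = lev j].

Definition restr j E : set (S * S) :=
  E `&` [set p | layer j p.1 /\ layer j p.2].

Definition joined j E : Prop :=
  exists x y, [/\ rho x = lev j, (rho y < lev j)%N & E (x, y)].

Definition agree n E F : Prop := forall x y, (rho x < n)%N -> (rho y < n)%N ->
  E (x, y) <-> F (x, y).

Lemma joinedS j E F : E `<=` F -> joined j E -> joined j F.
Proof. by move=> EF [x [y [? ? /EF ?]]]; exists x, y. Qed.

Lemma joined1 E : ~ joined j1 E.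
Proof.
move=> [x [y [_]]]; have [j ->] := lev_cover y.
by rewrite ltnNge lev1.
Qed.

Lemma lt_levS x j : (rho x < (lev j).+1)%N -> rho x = lev j \/ (rho x < lev j)%N.
Proof. by rewrite ltnS leq_eqVlt => /orP[/eqP|]; [left|right]. Qed.

Lemma restr_local j E : LCong S E -> ~ joined j E -> local_cong (layer j) (restr j E).
Proof.
move=> [[Er Es Et] Em] nj; split=> [x y []//|x Kx|x y [Exy [/= Kx Ky]]|x y z|s x y].
- by split=> //; apply: Er.
- by split=> //=; apply: Es.
- by move=> [Exy [/= Kx Ky]] [Eyz [/= _ Kz]]; split=> //=; apply: Et Eyz.
move=> [Exy [/= Kx Ky]]; have Esxy := Em s _ _ Exy.
have /lt_levS[sx|sx] : (rho (s * x) < (lev j).+1)%N by rewrite ltnS -Kx.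
  have /lt_levS[sy|sy] : (rho (s * y) < (lev j).+1)%N by rewrite ltnS -Ky.
    by left.
  by case: nj; exists (s * x), (s * y).
have /lt_levS[sy|sy] : (rho (s * y) < (lev j).+1)%N by rewrite ltnS -Ky.
  by case: nj; exists (s * y), (s * x); split=> //; apply: Es.
by right; split=> /= e; [move: sx|move: sy]; rewrite e ltnn.
Qed.

Lemma LCong1 E s x y : LCong S E -> E (x, y) -> E (lmul1 s x, lmul1 s y).
Proof. by case: s => [s|] //= [_ Em]; apply: Em. Qed.

Lemma rhoM1 s x : (rho (lmul1 s x) <= rho x)%N.
Proof. by case: s => /=. Qed.

(** Joining is all or nothing on a layer: if one a in the layer is related to b
    below it, then every x in the layer is s a for some s, hence is related to
    s b. *)
Lemma joined_below j E x : LCong S E -> joined j E -> (rho x < (lev j).+1)%N ->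
  exists2 y, (rho y < lev j)%N & E (x, y).
Proof.
move=> CE [a [b [aj bj Eab]]] /lt_levS[xj|xj]; last first.
  by exists x => //; have [[Er _ _] _] := CE; apply: Er.
have [|s sax] := @rho_trans a x; first by rewrite aj xj.
exists (lmul1 s b); first by apply: leq_ltn_trans bj; exact: rhoM1.
by rewrite -sax; apply: LCong1.
Qed.

(** Both elements of a pair in F can be moved below the layer along E, where E
    and F agree. *)
Lemma joined_agree j E F : LCong S E -> LCong S F -> E `<=` F -> joined j E ->
  agree (lev j) E F -> agree (lev j).+1 E F.
Proof.
move=> CE CF EF jE EFj x y xj yj; split=> [/EF//|Fxy].
have [x' x'j Exx'] := joined_below CE jE xj.
have [y' y'j Eyy'] := joined_below CE jE yj.
have [[Er Es Et] _] := CE; have [[Fr Fs Ft] _] := CF.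
apply: (Et _ _ _ Exx'); apply: (Et _ y'); last exact: Es.
apply/EFj => //; apply: (Ft _ _ _ _ (EF _ Eyy')); apply: (Ft _ _ _ _ Fxy).
exact/Fs/EF.
Qed.

Lemma unjoined_agree j E F : LCong S E -> LCong S F ->
  ~ joined j E -> ~ joined j F -> restr j E = restr j F ->
  agree (lev j) E F -> agree (lev j).+1 E F.
Proof.
have sub A B x y : LCong S A -> ~ joined j A -> restr j A = restr j B ->
    agree (lev j) A B -> (rho x < (lev j).+1)%N -> (rho y < (lev j).+1)%N ->
    A (x, y) -> B (x, y).
  move=> [[_ As _] _] nA AB ABj /lt_levS[xj|xj] /lt_levS[yj|yj] Axy.
  - have : restr j A (x, y) by split.
    by rewrite AB => -[].
  - by case: nA; exists x, y.
  - by case: nA; exists y, x; split=> //; apply: As.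
  - exact/ABj.
move=> CE CF nE nF EF EFj x y xj yj; split; first exact: sub.
apply: sub => // a b aj bj; apply: iff_sym; exact: EFj.
Qed.

Lemma first_disagreement E F : E <> F ->
  exists2 k, agree (lev k) E F & ~ agree (lev k).+1 E F.
Proof.
move=> EF.
have level x y : exists2 k, (rho x < (lev k).+1)%N && (rho y < (lev k).+1)%N &
    lev k = maxn (rho x) (rho y).
  have [a xa] := lev_cover x; have [b yb] := lev_cover y.
  have [ab|ba] := leqP (lev a) (lev b).
    by exists b; rewrite ?xa ?yb ?ltnS ?ab ?leqnn ?(maxn_idPr ab).
  by exists a; rewrite ?xa ?yb ?ltnS ?(ltnW ba) ?leqnn ?(maxn_idPl (ltnW ba)).
pose dis k := `[< ~ agree (lev k).+1 E F >].
have [k0 k0P] : exists k, dis k.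
  apply: contrapT => nk; apply: EF; apply/seteqP.
  suff EF x y : E (x, y) <-> F (x, y) by split=> -[x y] /EF.
  have [k /andP[xk yk] _] := level x y.
  have : agree (lev k).+1 E F.
    by apply: contrapT => h; apply: nk; exists k; apply/asboolP.
  exact.
case: (arg_minnP lev k0P) => k /asboolP kP kmin; exists k => // x y xk yk.
have [l /andP[xl yl] lE] := level x y.
have : agree (lev l).+1 E F.
  apply: contrapT => h; have := kmin l; rewrite lE => /(_ (introT (asboolP _) h)).
  by rewrite leqNgt gtn_max xk yk.
exact.
Qed.

(** At the layer j, the chain C can be climbed from E by a step that changes the
    layer j but nothing below it. Such steps are what a chain of local
    congruences of the layer can count. *)
Definition moves_at (C : set (set (S * S))) j E : Prop := ~ joined j E /\
  exists F, [/\ C F, E `<=` F, agree (lev j) E F & ~ agree (lev j).+1 E F].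

Lemma last_move C E : exists j, [/\ ~ joined j E, j = j1 \/ moves_at C j E &
  forall k, moves_at C k E -> (lev k <= lev j)%N].
Proof.
pose Q j := `[< j = j1 \/ moves_at C j E >].
have Q1 : Q j1 by apply/asboolP; left.
case: (arg_maxnP lev Q1) => j /asboolP Qj jmax; exists j; split=> //.
  by case: Qj => [->|[]//]; exact: joined1.
by move=> k fk; apply: jmax; apply/asboolP; right.
Qed.

(** Send E to the last layer at which C moves E (the lowest layer if there is
    none), together with the restriction of E to it. To see that this is
    injective, let E be contained in F with the same image, at the layer j, and
    let k be the first layer at which they differ. At k the smaller one E is
    not joined, so C moves E there, which forces k <= j. If k = j, then the equal
    restrictions contradict the choice of k. If k < j, take the witness E' of
    the move of E at j: it agrees with E up to k, so it does not contain F, hence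
    lies between E and F; so it has the same restriction to j as E, which
    contradicts that it differs from E there. *)
Lemma LCong_chain_split C : chains (LCong S) C ->
  exists D : J -> set (set (S * S)),
    (forall j, chains (local_cong (layer j)) (D j)) /\
    C #<= [set p : J * set (S * S) | D p.1 p.2].
Proof.
move=> [CS Ctot].
have tot E F : C E -> C F -> E `<=` F \/ F `<=` E.
  by move=> CE CF; have := Ctot E F CE CF; rewrite !subsetEset.
exists (fun j => restr j @` [set E | C E /\ ~ joined j E]); split=> [j|].
  split=> [_ [E [/CS CE nE] <-]|_ _ [E [CE _] <-] [F [CF _] <-]].
    exact: restr_local.
  rewrite !subsetEset.
  by have [EF|FE] := tot E F CE CF; [left|right]; apply: setSI.
have /choice[g gP] : forall E, exists j, [/\ ~ joined j E, j = j1 \/ moves_at C j E &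
  forall k, moves_at C k E -> (lev k <= lev j)%N] by exact: last_move.
apply: (@card_le_of_inj _ _ _ _ (fun E => (g E, restr (g E) E))) => [E CE|].
  by exists E => //; split=> //; have [] := gP E.
suff main E F : C E -> C F -> E `<=` F ->
    (g E, restr (g E) E) = (g F, restr (g F) F) -> E = F.
  move=> E F CE CF e; have [EF|FE] := tot E F CE CF; first exact: main.
  exact/esym/main.
move=> CE CF EF [gEF]; rewrite -gEF => rEF; apply: contrapT => nEF.
have [nE QE maxE] := gP E; have [nF _ _] := gP F; move: nF; rewrite -gEF => nF.
have [LE LF] := (CS _ CE, CS _ CF).
have [k kEF nkEF] := first_disagreement nEF.
have nEk : ~ joined k E by move=> jE; apply/nkEF/joined_agree.
have := maxE k (conj nEk (ex_intro _ F (And4 CF EF kEF nkEF))).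
rewrite leq_eqVlt => /orP[/eqP/lev_inj kg|klt].
  by subst k; apply: nkEF; apply: unjoined_agree.
case: QE => [g1|[_ [E' [CE' EE' agE' nagE']]]].
  by move: klt; rewrite g1 ltnNge lev1.
(* [E'] agrees with [E] up to the layer [k], where [F] is strictly larger. *)
have [FE'|E'F] := tot _ _ CF CE'.
  apply: nkEF => x y xk yk; split=> [/EF//|/FE'].
  by move/agE'; apply; apply: leq_trans klt.
apply: nagE'; apply: unjoined_agree => //; first exact: CS.
  by move/(joinedS E'F).
apply/seteqP; split; first exact: setSI.
by rewrite rEF; exact: setSI.
Qed.

Definition extend j N : set (S * S) :=
  [set p | [\/ p.1 = p.2, (rho p.1 < lev j)%N /\ (rho p.2 < lev j)%N | N p]].

Lemma extend_LCong j N : local_cong (layer j) N -> LCong S (extend j N).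
Proof.
move=> [NK Nr Ns Nt Nm].
have notlow x : layer j x -> (rho x < lev j)%N -> False by move=> /= ->; rewrite ltnn.
split; first split=> [x|x y|x y z].
- by constructor 1.
- by case=> /= [->|[]|/Ns]; [constructor 1|constructor 2|constructor 3].
- case=> /= [->//|[xj yj]|Nxy].
    by case=> /= [<-|[_ zj]|/NK[/notlow]//]; constructor 2.
  case=> /= [<-|[yj _]|/(Nt _ _ _ Nxy)]; do 1?by constructor 3.
  by have [_ /notlow] := NK _ _ Nxy.
move=> a x y [/= ->|[xj yj]|Nxy]; first by constructor 1.
  by constructor 2; split=> /=; apply: leq_ltn_trans (rhoM _ _) _.
have [xj yj] := NK _ _ Nxy.
have [|[ax ay]] := Nm a _ _ Nxy; first by constructor 3.
constructor 2 => /=; split; rewrite ltn_neqAle.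
  by rewrite -{2}xj rhoM andbT; apply/eqP.
by rewrite -{2}yj rhoM andbT; apply/eqP.
Qed.

Lemma extendS j N M : N `<=` M -> extend j N `<=` extend j M.
Proof. by move=> NM p [?|?|/NM ?]; [constructor 1|constructor 2|constructor 3]. Qed.

Lemma extend_lt j k N M : local_cong (layer j) N -> (lev j < lev k)%N ->
  extend j N `<=` extend k M.
Proof.
move=> [NK _ _ _ _] jk [x y] [/= ->|[xj yj]|/NK[xj yj]]; first by constructor 1.
  by constructor 2; split=> /=; apply: ltn_trans jk.
by constructor 2 => /=; rewrite xj yj.
Qed.

Definition first_full : set (S * S) := [set p | layer j1 p.1 /\ layer j1 p.2].

(** The universal relation on the lowest layer and the equality relation on the
    next one extend to the same left congruence. To keep the members of the
    chain distinct, the former is replaced by the universal relation on S. *)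
Definition stack (p : J * set (S * S)) : set (S * S) :=
  if `[< p = (j1, first_full) >] then setT else extend p.1 p.2.

Lemma extend_inj j N M : local_cong (layer j) N -> local_cong (layer j) M ->
  extend j N = extend j M -> N = M.
Proof.
have sub A B : local_cong (layer j) A -> local_cong (layer j) B ->
    extend j A = extend j B -> A `<=` B.
  move=> [AK _ _ _ _] [_ Br _ _ _] AB [x y] Axy; have [xj yj] := AK _ _ Axy.
  have : extend j B (x, y) by rewrite -AB; constructor 3.
  case=> //= [<-|[]]; first exact: Br.
  by rewrite xj ltnn.
by move=> LN LM NM; apply/seteqP; split; apply: sub.
Qed.

(** Apart from the exceptional case, a member of the stack at the layer j does
    not collapse everything up to j, whereas all later members do. *)
Lemma extend_isolates j N : local_cong (layer j) N -> (j, N) <> (j1, first_full) ->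
  exists x y, [/\ (rho x < (lev j).+1)%N, (rho y < (lev j).+1)%N & ~ extend j N (x, y)].
Proof.
move=> LN jN; have [NK Nr _ _ _] := LN.
have [x xj] := lev_hit j; have [j1E|j1j] := eqVneq j j1; last first.
  have lt1 : (lev j1 < lev j)%N by rewrite ltn_neqAle lev1 (inj_eq lev_inj) eq_sym j1j.
  have [y yj] := lev_hit j1; exists x, y; rewrite xj yj ltnS leqnn ltnS lev1.
  split=> // -[/= xy|[]|/NK[_ /= yj']].
  - by move: lt1; rewrite -xj -yj xy ltnn.
  - by rewrite xj ltnn.
  - by move: lt1; rewrite -yj yj' ltnn.
subst j; apply: contrapT => h; apply: jN; congr pair; apply/seteqP; split.
  by move=> [a b] /NK[].
move=> [a b] [/= aj bj]; have : extend j1 N (a, b).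
  by apply: contrapT => nab; apply: h; exists a, b; rewrite aj bj ltnSn.
case=> //= [<-|[]]; first exact: Nr.
by rewrite aj ltnn.
Qed.

Lemma LCong_chain_glue (D : J -> set (set (S * S))) :
  (forall j, chains (local_cong (layer j)) (D j)) ->
  exists2 C, chains (LCong S) C & [set p : J * set (S * S) | D p.1 p.2] #<= C.
Proof.
move=> DP.
have DL j N : D j N -> local_cong (layer j) N by have [h _] := DP j; exact: h.
exists (stack @` [set p | D p.1 p.2]).
  split=> [_ [[j N] /= /DL LN <-]|_ _ [[j N] /= DN <-] [[k M] /= DM <-]].
    rewrite /stack; case: asboolP => _; last exact: extend_LCong.
    by split=> //; split.
  rewrite !subsetEset /stack.
  case: asboolP => _; first by right.
  case: asboolP => _; first by left.
  have [jk|kj|/lev_inj jk] := ltngtP (lev j) (lev k).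
  - by left; apply: extend_lt => //; exact: DL.
  - by right; apply: extend_lt => //; exact: DL.
  - subst k; have [_ tot] := DP j; have := tot N M DN DM; rewrite !subsetEset.
    by case=> ?; [left|right]; apply: extendS.
apply: (@card_le_of_inj _ _ _ _ stack) => [p Dp|]; first by exists p.
have lt_neq j N k M : local_cong (layer j) N -> (j, N) <> (j1, first_full) ->
    (lev j < lev k)%N -> extend j N <> extend k M.
  move=> LN jN jk e; have [x [y [xj yj]]] := extend_isolates LN jN.
  apply; rewrite e; constructor 2 => /=; split; exact: leq_trans jk.
move=> [j N] [k M] /= /DL LN /DL LM; rewrite /stack /=.
case: asboolP => [->|jN].
  case: asboolP => [->//|kM e].
  by have [x [y [_ _]]] := extend_isolates LM kM; rewrite -e; case.
case: asboolP => [_ e|kM].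
  by have [x [y [_ _]]] := extend_isolates LN jN; rewrite e; case.
have [jk|kj|/lev_inj jk] := ltngtP (lev j) (lev k).
- by move/lt_neq => /(_ LN jN jk).
- by move/esym/lt_neq => /(_ LM kM kj).
- by subst k => /(extend_inj LN LM) ->.
Qed.

Lemma height_LCong_layers :
  [set: height (LCong S)] #= [set: {j : J & height (local_cong (layer j))}].
Proof. apply: height_sum; [exact: LCong_chain_split|exact: LCong_chain_glue]. Qed.

End Decomposition.
End LocalCongruences.

(** * Green's relations *)

Section Green.
Variable S : semigroupType.
Implicit Types (x y z : S) (t u : option S) (K : set S) (E F : set (S * S)).

Lemma lideal_lmul1 t x : lideal x (lmul1 t x).
Proof. by case: t => [a|]; [exists (Some a)|exact: lideal_refl]. Qed.

Lemma rideal_rmul1 t x : rideal x (rmul1 x t).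
Proof. by case: t => [a|]; [exists (Some a)|exact: rideal_refl]. Qed.

Lemma rmul1_mul a x t : rmul1 (a * x) t = a * rmul1 x t.
Proof. exact: (rmul1_lmul1 (Some a)). Qed.

Lemma lideal_mul s x : lideal (s * x) `<=` lideal x.
Proof. exact/lideal_sub/(lideal_lmul1 (Some s)). Qed.

Lemma greenL_lmul1 x y : lideal x = lideal y -> exists t, lmul1 t x = y.
Proof. by move=> xy; have := lideal_refl y; rewrite -xy => -[t _ <-]; exists t. Qed.

Lemma greenR_rmul1 x y : rideal x = rideal y -> exists2 t, S1 S t & rmul1 x t = y.
Proof. by move=> xy; have := rideal_refl y; rewrite -xy => -[t tS <-]; exists t. Qed.

Lemma lideal_eq x y t u : lmul1 t x = y -> lmul1 u y = x -> lideal x = lideal y.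
Proof.
move=> txy uyx; apply/seteqP.
by split; apply: lideal_sub; [rewrite -uyx|rewrite -txy]; exact: lideal_lmul1.
Qed.

Lemma rideal_eq x y t u : rmul1 x t = y -> rmul1 y u = x -> rideal x = rideal y.
Proof.
move=> txy uyx; apply/seteqP.
by split; apply: rideal_sub; [rewrite -uyx|rewrite -txy]; exact: rideal_rmul1.
Qed.

Lemma greenL_rmul x y t : lideal x = lideal y -> lideal (rmul1 x t) = lideal (rmul1 y t).
Proof.
move=> xy; have [a ax] := greenL_lmul1 xy; have [b bx] := greenL_lmul1 (esym xy).
by apply: (@lideal_eq _ _ a b); rewrite -rmul1_lmul1 ?ax ?bx.
Qed.

(** Green's lemma: z = a x for some a, and left multiplication by a commutes
    with the right translations. *)
Lemma translationK x z t u : lideal x = lideal z ->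
  rmul1 (rmul1 x t) u = x -> rmul1 (rmul1 z t) u = z.
Proof. by move=> /greenL_lmul1[a <-] xtu; rewrite !rmul1_lmul1 xtu. Qed.

Lemma LclassP K x y : Lclasses S K -> K x -> K y <-> lideal x = lideal y.
Proof.
move=> [z _ <-] /= zx; split=> [zy|xy]; first by exact: etrans (esym zx) zy.
exact: etrans zx xy.
Qed.

Lemma Lclass_inh K : Lclasses S K -> exists x, K x.
Proof. by move=> [z _ <-]; exists z. Qed.

Lemma Lclass_eq K K' x : Lclasses S K -> Lclasses S K' -> K x -> K' x -> K = K'.
Proof.
move=> KL KL' Kx K'x; apply/seteqP; split=> y.
  by rewrite (LclassP y KL Kx) -(LclassP y KL' K'x).
by rewrite (LclassP y KL' K'x) -(LclassP y KL Kx).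
Qed.

(** R and L commute. With y = x t and x = y u, the element w = z u closes the
    square. *)
Lemma greenRL_comm x y z : rideal x = rideal y -> lideal y = lideal z ->
  exists2 w, lideal x = lideal w & rideal w = rideal z.
Proof.
move=> xRy yLz; have [t _ xt] := greenR_rmul1 xRy.
have [u _ yu] := greenR_rmul1 (esym xRy).
exists (rmul1 z u); first by rewrite -{1}yu; exact: greenL_rmul.
apply: (@rideal_eq _ _ t u) => //; apply: translationK yLz _.
by rewrite yu xt.
Qed.

(** As L and R commute, their composition is already an equivalence. *)
Lemma greenD_LR x y : greenD S (x, y) ->
  exists2 z, lideal x = lideal z & rideal z = rideal y.
Proof.
pose LR := [set p : S * S | exists2 z, lideal p.1 = lideal z & rideal z = rideal p.2].
apply: (_ : smallest _ _ `<=` LR); apply: smallest_sub; last first.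
  move=> [a b] [ab|ab]; first by exists b.
  by exists a.
split=> [a|a b [z /= az zb]|a b c [z /= az zb] [w /= bw wc]]; first by exists a.
- by have [q] := greenRL_comm (esym zb) (esym az); exists q.
- have [q zq qw] := greenRL_comm zb bw.
  by exists q; [exact: etrans az zq|exact: etrans qw wc].
Qed.

(** Transport along the translation by t, whose inverse is the translation by u;
    since they commute with left multiplication, s x is in K if and only if
    s x t is in K'. *)
Lemma height_local_cong_R K K' x y : Lclasses S K -> Lclasses S K' ->
  K x -> K' y -> rideal x = rideal y ->
  [set: height (local_cong K)] #<= [set: height (local_cong K')].
Proof.
move=> KL KL' Kx K'y xRy.
have [t _ xt] := greenR_rmul1 xRy; have [u _ yu] := greenR_rmul1 (esym xRy).
have tK z : K z -> rmul1 (rmul1 z t) u = z.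
  by move/(LclassP z KL Kx) => xz; apply: translationK xz _; rewrite xt yu.
have uK z : K' z -> rmul1 (rmul1 z u) t = z.
  by move/(LclassP z KL' K'y) => yz; apply: translationK yz _; rewrite yu xt.
have tP z : K z -> K' (rmul1 z t).
  move=> /(LclassP z KL Kx) xz; apply/(LclassP _ KL' K'y).
  by rewrite -xt; exact: greenL_rmul.
have uP z : K' z -> K (rmul1 z u).
  move=> /(LclassP z KL' K'y) yz; apply/(LclassP _ KL Kx).
  by rewrite -yu; exact: greenL_rmul.
pose tr E : set (S * S) := [set p | exists a b,
  [/\ E (a, b), p.1 = rmul1 a t & p.2 = rmul1 b t]].
apply: (@height_embed _ _ _ _ _ _ tr).
- move=> E [EK Er Es Et Em]; split.
  + by move=> _ _ [a [b [/EK[Ka Kb] /= -> ->]]]; split; apply: tP.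
  + move=> z K'z; exists (rmul1 z u), (rmul1 z u); rewrite uK //; split=> //.
    exact/Er/uP.
  + by move=> _ _ [a [b [Eab /= -> ->]]]; exists b, a; split=> //; apply: Es.
  + move=> _ _ _ [a [b [Eab /= -> ->]]] [b' [c [Ebc /= bb' ->]]].
    have [[Ka Kb] [Kb' Kc]] := (EK _ _ Eab, EK _ _ Ebc).
    exists a, c; split=> //; apply: Et Eab _.
    by rewrite -(tK b) // bb' tK.
  + move=> s _ _ [a [b [Eab /= -> ->]]]; have [Ka Kb] := EK _ _ Eab.
    rewrite -!rmul1_mul; have [Es'|[na nb]] := Em s _ _ Eab.
      by left; exists (s * a), (s * b).
    by right; split=> /uP; rewrite !rmul1_mul tK.
- by move=> E F _ _; rewrite !subsetEset => EF [p q] [a [b [/EF ? ? ?]]]; exists a, b.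
- have sub E F : local_cong K E -> local_cong K F -> tr E = tr F -> E `<=` F.
    move=> [EK _ _ _ _] [FK _ _ _ _] EF [a b] Eab.
    have [Ka Kb] := EK _ _ Eab.
    have : tr F (rmul1 a t, rmul1 b t) by rewrite -EF; exists a, b.
    move=> [c [d [Fcd /= ac bd]]]; have [Kc Kd] := FK _ _ Fcd.
    by rewrite -(tK a) // -(tK b) // ac bd !tK.
  by move=> E F LE LF EF; apply/seteqP; split; apply: sub.
Qed.

Lemma greenD_equiv : is_equiv (greenD S).
Proof.
split=> [a|a b|a b c].
- by move=> A [[Ar _ _] _]; exact: Ar.
- by move=> ab A AP; have [[_ As _] _] := AP; apply: As; exact: ab.
- move=> ab bc A AP; have [[_ _ At] _] := AP; apply: (At _ b); first exact: ab.
  exact: bc.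
Qed.

Lemma greenL_sub_greenD x y : lideal x = lideal y -> greenD S (x, y).
Proof. by move=> xy A [_ subA]; apply: subA; left. Qed.

Lemma DclassP D x y : Dclasses S D -> D x -> D y <-> greenD S (x, y).
Proof.
have [_ Ds Dt] := greenD_equiv; move=> [z _ <-] /= zx.
by split; [apply: Dt; exact: Ds|exact: Dt].
Qed.

Lemma Dclass_eq D D' x : Dclasses S D -> Dclasses S D' -> D x -> D' x -> D = D'.
Proof.
move=> DD DD' Dx D'x; apply/seteqP; split=> y.
  by rewrite (DclassP y DD Dx) -(DclassP y DD' D'x).
by rewrite (DclassP y DD' D'x) -(DclassP y DD Dx).
Qed.

Lemma Lclass_sub_Dclass K D x : Lclasses S K -> Dclasses S D -> K x -> D x -> K `<=` D.
Proof.
move=> KL DD Kx Dx y /(LclassP y KL Kx) xy.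
by apply/(DclassP y DD Dx); exact: greenL_sub_greenD.
Qed.

Lemma height_local_cong_D D K K' : Dclasses S D -> Lclasses S K -> Lclasses S K' ->
  K `<=` D -> K' `<=` D ->
  [set: height (local_cong K)] #= [set: height (local_cong K')].
Proof.
move=> DD; suff main A B : Lclasses S A -> Lclasses S B -> A `<=` D -> B `<=` D ->
    [set: height (local_cong A)] #<= [set: height (local_cong B)].
  by move=> *; apply: card_eq_le_le; apply: main.
move=> AL BL AD BD; have [x Ax] := Lclass_inh AL; have [y By] := Lclass_inh BL.
have [z xz zy] := greenD_LR (proj1 (DclassP y DD (AD _ Ax)) (BD _ By)).
by apply: height_local_cong_R zy => //; apply/(LclassP z AL Ax).
Qed.

(** A linear extension of the order of L-classes. The number [cnt x] of L-classes
    at or below that of x is strictly monotone, and the index [idx < n] in an arbitrary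
    enumeration breaks ties, as the remainder modulo n. *)
Lemma Lclass_rank : finite_set (Lclasses S) -> exists rho : S -> nat,
  (forall s x, (rho (s * x)%g <= rho x)%N) /\
  (forall x y, rho x = rho y <-> lideal x = lideal y).
Proof.
move=> finL; pose Lc x : set S := [set y | greenL S (x, y)].
have LcP x y : Lc x = Lc y <-> lideal x = lideal y.
  split=> [xy|xy]; first by (have : Lc x y by rewrite xy).
  by apply/seteqP; split=> z; rewrite /Lc /greenL /= xy.
have [n /card_eqPle[+ _]] := finL.
move=> /pcard_leP/injfunPex[idx idxlt idxinj].
have LcL x : Lclasses S (Lc x) by exists x.
pose below x : set (set S) := Lc @` lideal x.
have finB x : finite_set (below x).
  by apply: sub_finite_set finL => _ [y _ <-].
pose cnt x := #|` fset_set (below x)|%fset.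
exists (fun x => cnt x * n + idx (Lc x))%N; split=> [s x|x y].
  have [sx|sx] := pselect (lideal (s * x) = lideal x).
    by rewrite /cnt /below sx (proj2 (LcP _ _) sx).
  suff lt_cnt : (cnt (s * x)%g < cnt x)%N.
    apply: (@leq_trans ((cnt (s * x)%g).+1 * n)).
      by rewrite mulSn addnC leq_add2r ltnW //; exact: idxlt.
    by rewrite -(addn0 (_ * n))%N leq_add // leq_mul2r lt_cnt orbT.
  apply: fproper_ltn_card; rewrite fproperEneq.
  have sub : below (s * x) `<=` below x by apply: image_subset; exact: lideal_mul.
  have := sub; rewrite fset_set_sub // => ->; rewrite andbT.
  apply/eqP => /(fset_set_inj (finB _) (finB _)) e.
  have : below (s * x) (Lc x) by rewrite e; exists x => //; exact: lideal_refl.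
  move=> [z sxz /LcP zx]; apply: sx; apply/seteqP; split; first exact: lideal_mul.
  by rewrite -zx; exact: lideal_sub.
split=> [e|xy]; last by rewrite /cnt /below xy (proj2 (LcP _ _) xy).
apply/LcP; apply: idxinj; rewrite ?inE //.
by have := congr1 (modn ^~ n) e; rewrite !modnMDl !modn_small //; exact: idxlt.
Qed.

Lemma height_LCong (J : finType) (K : J -> set S) (j0 : J) :
  finite_set (Lclasses S) -> (forall j, Lclasses S (K j)) -> injective K ->
  (forall A, Lclasses S A -> exists j, K j = A) ->
  [set: height (LCong S)] #= [set: {j : J & height (local_cong (K j))}].
Proof.
move=> finL KL Kinj Ksurj; have [rho [rhoM rhoL]] := Lclass_rank finL.
have /choice[rep repP] : forall j, exists x, K j x by move=> j; exact: Lclass_inh.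
pose lev j := rho (rep j).
have KE j : K j = layer rho lev j.
  apply/seteqP; split=> x; rewrite /layer /lev /= rhoL.
    by move/(LclassP _ (KL j) (repP j)).
  by move=> e; apply/(LclassP _ (KL j) (repP j)).
have -> : (fun j => height (local_cong (K j))) =
          (fun j => height (local_cong (layer rho lev j))).
  by apply/funext => j; rewrite KE.
have [j1 _ j1min] := arg_minnP lev (erefl : xpredT j0).
apply: (@height_LCong_layers _ rho J lev j1) => //.
- by move=> x y /rhoL; exact: greenL_lmul1.
- move=> i j ij; apply: Kinj; apply: (Lclass_eq (KL i) (KL j) (repP i)).
  by rewrite KE.
- by move=> j; exists (rep j).
- move=> x; have [j jE] := Ksurj [set y | greenL S (x, y)] (ex_intro2 _ _ x I erefl).
  by exists j; have : K j x by [rewrite jE]; rewrite KE.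
- by move=> j; exact: j1min.
Qed.

Lemma height_local_cong_minimal (L : set S) (Lmin : minimal_Lclass L) :
  [set: height (local_cong L)] #= [set: height (Cong (minimal_act Lmin))].
Proof.
have mem x (Lx : L x) : exists a : set_type L, val a = x by exists (SigSub (mem_set Lx)).
apply: card_eq_le_le.
  pose f (E : set (S * S)) : set (minimal_act Lmin * minimal_act Lmin) :=
    [set p : set_type L * set_type L | E (val p.1, val p.2)].
  apply: (@height_embed _ _ _ _ _ _ f).
  - move=> E [EK Er Es Et Em]; split; first split=> [x|x y|x y z].
    + by apply: Er; exact: set_valP.
    + exact: Es.
    + exact: Et.
    + move=> s a b /(Em s)[//|[na _]]; case: na.
      by apply: (minimal_Lclass_stable s Lmin); exact: set_valP.
  - by move=> E F _ _; rewrite !subsetEset => EF p /EF.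
  - have sub E F : local_cong L E -> f E = f F -> E `<=` F.
      move=> [EK _ _ _ _] EF [x y] Exy; have [Lx Ly] := EK _ _ Exy.
      have [a ax] := mem x Lx; have [b bx] := mem y Ly; subst x y.
      by have : f E (a, b) by []; rewrite EF.
    by move=> E F LE LF EF; apply/seteqP; split; apply: sub.
pose g (F : set (minimal_act Lmin * minimal_act Lmin)) : set (S * S) :=
  (fun p : set_type L * set_type L => (val p.1, val p.2)) @` F.
apply: (@height_embed _ _ _ _ _ _ g).
- move=> F [[Fr Fs Ft] Fm]; split.
  + by move=> _ _ [[a b] _ /= [<- <-]]; split; exact: set_valP.
  + by move=> x /mem[a <-]; exists (a, a).
  + by move=> _ _ [[a b] /Fs Fba /= [<- <-]]; exists (b, a).
  + move=> _ _ z [[a b] Fab /= [<- <-]] [[b' c] Fbc /= [/val_inj bb' <-]].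
    by subst b'; exists (a, c) => //; exact: Ft Fbc.
  + move=> s _ _ [[a b] /(Fm s) Fab /= [<- <-]]; left.
    by exists (minimal_act_fun Lmin s a, minimal_act_fun Lmin s b).
- by move=> E F _ _; rewrite !subsetEset => EF; exact: image_subset.
- have sub (E F : set (minimal_act Lmin * minimal_act Lmin)) : g E = g F -> E `<=` F.
    move=> EF [a b] Eab; have : g F (val a, val b) by rewrite -EF; exists (a, b).
    by move=> [[c d] Fcd [/val_inj ca /val_inj db]]; subst c d.
  by move=> E F _ _ EF; apply/seteqP; split; apply: sub.
Qed.

End Green.

(** * The Schuetzenberger group of an H-separable L-class *)

Section Schutzenberger.
Variable S : semigroupType.
Variables (L H : set S) (LL : Lclasses S L) (hH : Hclasses S H) (HL : H `<=` L).
Local Notation G := (schutz hH).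
Implicit Types (x y : S) (t u : option S) (g f : G) (E F : set (S * S)) (N M : set G).

Definition represents t g := forall h : set_type H, val (val g h) = rmul1 (val h) t.

Lemma represented g : exists t, represents t g.
Proof. by have [t _ gt] := schutzP g; exists t. Qed.

Lemma schutz_mulE f g h : val (f * g) h = val f (val g h).
Proof. by []. Qed.

Lemma schutz_1E h : val (1 : G) h = h.
Proof. by []. Qed.

Lemma Hclass_inh : exists h : set_type H, True.
Proof.
have [z _ zH] := hH; have Hz : H z by rewrite -zH.
by exists (SigSub (mem_set Hz)).
Qed.

Lemma HLgreen (h : set_type H) x : L x <-> lideal (val h) = lideal x.
Proof. by apply: LclassP LL _; apply: HL; exact: set_valP. Qed.

Lemma represents_L t g x : represents t g -> L x -> L (rmul1 x t).
Proof.
move=> tg; have [h _] := Hclass_inh; rewrite !(HLgreen (val g h)).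
rewrite (_ : lideal (val (val g h)) = lideal (val h)).
  by move=> hx; rewrite -(greenL_rmul t hx) -tg; apply/HLgreen/HL; exact: set_valP.
by apply/HLgreen/HL; exact: set_valP.
Qed.

Lemma representsK t u g x : represents t g -> represents u g^-1 -> L x ->
  rmul1 (rmul1 x t) u = x.
Proof.
move=> tg ug; have [h _] := Hclass_inh; move/(HLgreen h) => hx.
apply: translationK hx _; rewrite -tg -ug -schutz_mulE mulVg.
by rewrite schutz_1E.
Qed.

Lemma represents_mul t u f g : represents t f -> represents u g ->
  exists2 w, represents w (f * g) & forall x, rmul1 x w = rmul1 (rmul1 x u) t.
Proof.
move=> tf ug; suff [w wE] : exists w, forall x, rmul1 x w = rmul1 (rmul1 x u) t.
  by exists w => // h; rewrite wE -ug -tf.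
case: t u {tf ug} => [a|] [b|]; last by exists None.
- by exists (Some (b * a)) => x /=; rewrite mulgA.
- by exists (Some a).
- by exists (Some b).
Qed.

(** The group acts freely on H: any two elements of H differ by a left
    multiplication, which commutes with the action. *)
Lemma schutz_free f g (h : set_type H) : val f h = val g h -> f = g.
Proof.
have [t tf] := represented f; have [u ug] := represented g.
move=> e; apply: val_inj; apply/funext => k; apply: val_inj.
have [a ah] : exists a, lmul1 a (val h) = val k.
  by apply: greenL_lmul1; apply/HLgreen/HL; exact: set_valP.
by rewrite tf ug -ah !rmul1_lmul1 -tf -ug e.
Qed.

(** The action of the group on H extends to all of L, by right multiplication
    with representatives; this is the orbit relation of a subgroup on L. *)
Definition orbit_rel N : set (S * S) :=
  [set p | L p.1 /\ exists g t, [/\ N g, represents t g & p.2 = rmul1 p.1 t]].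

Definition stab E : set G := [set g | forall h : set_type H, E (val h, val (val g h))].

(** If s x t is in L, then so is s x = s x t u, where u represents the inverse of
    g; hence s x and s x t are in L together. *)
Lemma orbit_rel_local N : Subgroups G N -> local_cong L (orbit_rel N).
Proof.
move=> NG; have N1 : N 1 by have [/set_mem] := NG.
have NV g : N g -> N g^-1 by move=> Ng; apply/set_mem/(group_closedV NG)/mem_set.
have NM f g : N f -> N g -> N (f * g).
  by move=> Nf Ng; apply/set_mem/(group_closedM NG); exact: mem_set.
split.
- by move=> x _ [/= Lx [g [t [_ tg /= ->]]]]; split=> //; exact: represents_L tg _.
- move=> x Lx; split=> //; exists 1; have [n|[e ide]] := S1_None_or_id S.
    by exists None.
  by exists (Some e); split=> //= [h|]; rewrite /= ?(proj2 (ide _)).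
- move=> x _ [/= Lx [g [t [Ng tg ->]]]]; have [u ug] := represented g^-1.
  split=> /=; first exact: represents_L tg _.
  by exists g^-1, u; rewrite (representsK tg ug) //; split=> //; exact: NV.
- move=> x _ _ [/= Lx [g [t [Ng tg ->]]]] [/= _ [f [u [Nf uf ->]]]]; split=> //=.
  have [w wfg wE] := represents_mul uf tg.
  by exists (f * g), w; rewrite wE; split=> //; exact: NM.
move=> s x _ [/= Lx [g [t [Ng tg ->]]]]; have [u ug] := represented g^-1.
rewrite -rmul1_mul.
have [Lsx|nLsx] := pselect (L (s * x)); [left|right].
  by split=> //; exists g, t.
split=> // Lsxt; apply: nLsx.
have -> : s * x = rmul1 (rmul1 (s * x) t) u.
  by rewrite !rmul1_mul (representsK tg ug).
exact: represents_L ug _.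
Qed.

Lemma stab_subgroup E : local_cong L E -> Subgroups G (stab E).
Proof.
move=> [EL Er Es Et Em].
split=> [|f g /set_mem Ef /set_mem Eg].
  by apply: mem_set => h; apply: Er; apply: HL; exact: set_valP.
apply: mem_set => h; rewrite schutz_mulE.
apply: (Et _ (val (val g^-1 h))); last exact: Ef.
have := Eg (val g^-1 h); rewrite -schutz_mulE mulgV schutz_1E; exact: Es.
Qed.

Lemma orbit_relK N : Subgroups G N -> stab (orbit_rel N) = N.
Proof.
move=> NG; apply/seteqP; split=> [g sg|g Ng h].
  have [h _] := Hclass_inh; have [/= _ [f [t [Nf tf ghE]]]] := sg h.
  have e : val f h = val g h by apply: val_inj; rewrite tf -ghE.
  by rewrite -(schutz_free e).
have [t tg] := represented g; split=> /=; first by apply: HL; exact: set_valP.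
by exists g, t; split=> //; exact: tg.
Qed.

(** For (x, y) in E, H-separability gives that x and y are H-related, so y = x t
    with t acting on L as an element of the group; left multiplications then
    carry the pair (x, x t) to every pair (h, h t) with h in H. *)
Lemma stabK E : Hseparable L -> local_cong L E -> orbit_rel (stab E) = E.
Proof.
move=> Lsep [EL Er Es Et Em]; apply/seteqP.
split=> [[x _] [/= Lx [g [t [Eg tg ->]]]]|[x y] Exy].
  have [h _] := Hclass_inh; have [a ahx] := greenL_lmul1 (proj1 (HLgreen h x) Lx).
  have := Eg h; rewrite tg -ahx rmul1_lmul1; case: a ahx => [a|//] /= ahx /(Em a)[//|].
  by rewrite ahx => -[].
have [Lx Ly] := EL _ _ Exy.
have xRy : rideal x = rideal y.
  apply: contrapT => nxy; have nH : ~ greenH S (x, y) by case.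
  have [s sxy] := Lsep _ _ Lx Ly nH.
  by have [/EL|] := Em s _ _ Exy; case: sxy => -[] => ? ? [].
have [t tS xt] := greenR_rmul1 xRy; have [u _ yu] := greenR_rmul1 (esym xRy).
have htu (h : set_type H) : rmul1 (rmul1 (val h) t) u = val h.
  by apply: (@translationK _ x); [rewrite ((HLgreen h x).1 Lx)|rewrite xt yu].
have Ht (h : set_type H) : H (rmul1 (val h) t).
  apply: (Hclass_in hH (x := h)).
    by rewrite (greenL_rmul t ((HLgreen h x).1 Lx)) xt; apply/HLgreen.
  by apply: (@rideal_eq _ _ _ t u).
pose g0 (h : set_type H) : set_type H := SigSub (mem_set (Ht h)).
have g0P : right_translations H g0 by exists t.
pose g : G := SigSub (mem_set g0P).
have tg : represents t g by [].
split=> //; exists g, t; split=> //= h; rewrite tg.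
have [a axh] := greenL_lmul1 (esym ((HLgreen h x).1 Lx)).
have Lh : L (val h) by apply: HL; exact: set_valP.
have := Exy; rewrite -xt -axh rmul1_lmul1; case: a axh => [a|//] /= axh /(Em a)[//|].
by rewrite axh => -[].
Qed.

Lemma height_local_cong_Hseparable : Hseparable L ->
  [set: height (local_cong L)] #= [set: height (Subgroups G)].
Proof.
move=> Lsep; apply: card_eq_le_le.
  apply: (@height_embed _ _ _ _ _ _ stab); first exact: stab_subgroup.
    by move=> E F _ _; rewrite !subsetEset => EF g Eg h; exact/EF/Eg.
  by move=> E F /(stabK Lsep) {2}<- /(stabK Lsep) {2}<- ->.
apply: (@height_embed _ _ _ _ _ _ orbit_rel); first exact: orbit_rel_local.
  move=> N M _ _; rewrite !subsetEset => NM p [Lp [g [t [/NM Mg tg pE]]]].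
  by split=> //; exists g, t.
by move=> N M /orbit_relK {2}<- /orbit_relK {2}<- ->.
Qed.

End Schutzenberger.

(** * The height of the lattice of left congruences *)

Theorem theorem7p11 (S : semigroupType) (n : nat)
    (L : 'I_n.+1 -> set S) (H : 'I_n.+1 -> set S) (m : 'I_n.+1 -> nat)
    (finL : finite_set (Lclasses S))
    (Lclass : forall r, Lclasses S (L r))
    (Lrep : forall D, Dclasses S D -> exists! r, L r `<=` D)
    (Lmin : minimal_Lclass (L ord0))
    (mE : forall r D, Dclasses S D -> L r `<=` D ->
       [set K | Lclasses S K /\ K `<=` D] #= `I_(m r))
    (Hclass : forall r, Hclasses S (H r))
    (HL : forall r, H r `<=` L r)
    (Lsep : forall r : 'I_n, Hseparable (L (lift ord0 r))) :
  [set: height (LCong S)] #=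
  [set: 'I_(m ord0) * height (Cong (minimal_act Lmin)) +
        {r : 'I_n &
          'I_(m (lift ord0 r)) * height (Subgroups (schutz (Hclass (lift ord0 r))))}].
Proof.
have /choice[D DP] : forall r, exists D, Dclasses S D /\ L r `<=` D.
  move=> r; have [x Lx] := Lclass_inh (Lclass r).
  have DD : Dclasses S [set y | greenD S (x, y)] by exists x.
  exists [set y | greenD S (x, y)]; split=> //.
  by apply: (Lclass_sub_Dclass (Lclass r) DD Lx); apply: greenL_sub_greenD.
have DD r : Dclasses S (D r) by have [] := DP r.
have LD r : L r `<=` D r by have [] := DP r.
(* [enumL r] lists the [m r] L-classes of the D-class of [L r]. *)
have /choice[enumL eP] : forall r, exists f : nat -> set S,
    set_bij `I_(m r) [set K | Lclasses S K /\ K `<=` D r] f.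
  by move=> r; apply/card_set_bijP/card_esym/mE.
pose J := ('I_(m ord0) + {r : 'I_n & 'I_(m (lift ord0 r))})%type.
pose row (j : J) : 'I_n.+1 := match j with inl _ => ord0 | inr p => lift ord0 (tag p) end.
pose col (j : J) : nat := match j with inl i => i | inr p => tagged p end.
pose K j := enumL (row j) (col j).
have colP j : `I_(m (row j)) (col j).
  by case: j => [i|[r i]]; exact: ltn_ord.
have KP j : Lclasses S (K j) /\ K j `<=` D (row j).
  by have [kf _ _] := eP (row j); exact: kf.
have row_col j j' : row j = row j' -> col j = col j' -> j = j'.
  move: j j' => [i|[r i]] [i'|[r' i']] //=; rewrite /row /col /=.
  - by move=> _ /val_inj ->.
  - by move=> /lift_inj rr'; subst r' => /val_inj ->.
have Kinj : injective K.
  move=> j j' KK; have [[Kj KD] [_ KD']] := (KP j, KP j').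
  have rr : row j = row j'.
    have [r [_ runiq]] := Lrep _ (DD (row j)).
    rewrite -(runiq _ (LD _)); apply: runiq.
    have [x Kx] := Lclass_inh Kj; have Kx' : K j' x by rewrite -KK.
    by rewrite (Dclass_eq (DD _) (DD _) (KD _ Kx) (KD' _ Kx')); exact: LD.
  apply: row_col => //; have [_ kinj _] := eP (row j).
  by apply: kinj; rewrite ?inE; [exact: colP|rewrite rr; exact: colP|rewrite {2}rr].
have Ksurj A : Lclasses S A -> exists j, K j = A.
  move=> AL; have [x Ax] := Lclass_inh AL.
  have DDx : Dclasses S [set y | greenD S (x, y)] by exists x.
  have Dxx : greenD S (x, x) by exact: greenL_sub_greenD.
  have [r [Lr _]] := Lrep _ DDx; have [y Ly] := Lclass_inh (Lclass r).
  have [c cm cA] : exists2 c, `I_(m r) c & enumL r c = A.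
    have [_ _ ksurj] := eP r; apply: ksurj; split=> //.
    rewrite (Dclass_eq (DD r) DDx (LD _ _ Ly) (Lr _ Ly)).
    exact: Lclass_sub_Dclass AL DDx Ax Dxx.
  case: (unliftP ord0 r) cm cA => [s ->|->] cm cA.
    by exists (inr (existT _ s (Ordinal cm))).
  by exists (inl (Ordinal cm)).
have [j0 _] := Ksurj _ (Lclass ord0).
apply: (card_eq_trans (height_LCong j0 finL (fun j => (KP j).1) Kinj Ksurj)).
pose Y (j : J) : Type := match j with
  | inl _ => height (Cong (minimal_act Lmin))
  | inr p => height (Subgroups (schutz (Hclass (lift ord0 (tag p))))) end.
apply: (@card_eq_trans _ _ _ _ [set: {j : J & Y j}]).
  apply: card_eq_sum_cong => j.
  have [Kj KD] := KP j.
  apply: (card_eq_trans (height_local_cong_D (DD (row j)) Kj (Lclass _) KD (LD _))).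
  case: j {Kj KD} => [i|[r i]]; first exact: height_local_cong_minimal.
  by apply: (height_local_cong_Hseparable (Lclass _) (Hclass _)); [exact: HL|exact: Lsep].
pose W : Type := ('I_(m ord0) * height (Cong (minimal_act Lmin)) +
  {r : 'I_n & 'I_(m (lift ord0 r)) *
     height (Subgroups (schutz (Hclass (lift ord0 r))))})%type.
pose f (p : {j : J & Y j}) : W :=
  match p with
  | existT (inl i) y => inl (i, y)
  | existT (inr (existT r i)) y => inr (existT _ r (i, y))
  end.
pose g (q : W) : {j : J & Y j} :=
  match q with
  | inl (i, y) => existT Y (inl i) y
  | inr (existT r (i, y)) => existT Y (inr (existT _ r i)) y
  end.
apply: (@card_eq_can _ _ f g).
  by case=> [[i|[r i]] y].
by case=> [[i y]|[r [i y]]].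
Qed.
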